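(* For all combinators $u,v$: $u\equiv v$ if and only if $u\approx v$.
   Context: Combinators: $C ::= x \mid K \mid S \mid I \mid (C\ C)$ with $x$ ranging over variables; application associates to the left. $[x]u$ is defined by the first applicable rule: $[x]u=(K\ u)$ if $x\notin u$; $[x]x=I$; $[x](u\ x)=u$ if $x\notin u$; $[x](u\ v)=(S\ [x]u\ [x]v)$ otherwise. $\lambda x.u$ is defined by the first applicable rule: $\lambda x.u=(K\ u)$ if $x\notin u$; $\lambda x.x=I$; $\lambda x.(u\ v)=(S\ \lambda x.u\ \lambda x.v)$ otherwise. The strong reduction $\succ$ is the closure under application contexts of $(K\ u\ v)\succ u$, $(S\ u\ v\ w)\succ(u\ w\ (v\ w))$, $(I\ u)\succ u$, plus: $[x]u\succ[x]v$ whenever $u\succ v$. The reduction $\rightarrow$ is the closure under application contexts of $(K\ u\ v)\rightarrow u$, $(S\ u\ v\ w)\rightarrow(u\ w\ (v\ w))$, $(I\ u)\rightarrow u$, $(S\ (K\ u)\ (K\ v))\rightarrow(K\ (u\ v))$, $(S\ (K\ u)\ I)\rightarrow u$, plus: $\lambda x.u\rightarrow\lambda x.v$ whenever $u\rightarrow v$. $\equiv$ is the equivalence relation generated by $\succ$ (reflexive, symmetric, transitive closure) and $\approx$ the equivalence relation generated by $\rightarrow$. *)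

(* Defs.v *)
From Stdlib Require Import Arith Bool Relations.

Declare Scope comb_scope.

Inductive comb : Set :=
| Var : nat -> comb
| cK : comb
| cS : comb
| cI : comb
| App : comb -> comb -> comb.

Notation "u @ v" := (App u v) (at level 40, left associativity) : comb_scope.
Open Scope comb_scope.

Fixpoint occurs (x : nat) (t : comb) : bool :=
  match t with
  | Var y => Nat.eqb x y
  | cK | cS | cI => false
  | u @ v => occurs x u || occurs x v
  end.

Definition is_var (x : nat) (t : comb) : bool :=
  match t with
  | Var y => Nat.eqb x y
  | _ => false
  end.

(* The abstraction [x]t. Once [x] is known to occur in [t], a variable can only
   be [x] itself, and the constant cases are unreachable. *)
Fixpoint bracket (x : nat) (t : comb) : comb :=
  if negb (occurs x t) then cK @ t
  else match t with
       | Var _ => cI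
       | u @ v =>
           if is_var x v && negb (occurs x u) then u
           else cS @ bracket x u @ bracket x v
       | cK | cS | cI => cK @ t
       end.

(* The abstraction λx.t: as [bracket], without the rule [x](u x) = u. *)
Fixpoint lam (x : nat) (t : comb) : comb :=
  if negb (occurs x t) then cK @ t
  else match t with
       | Var _ => cI
       | u @ v => cS @ lam x u @ lam x v
       | cK | cS | cI => cK @ t
       end.

Inductive strong_red : comb -> comb -> Prop :=
| strong_K u v : strong_red (cK @ u @ v) u
| strong_S u v w : strong_red (cS @ u @ v @ w) (u @ w @ (v @ w))
| strong_I u : strong_red (cI @ u) u
| strong_appl u u' v : strong_red u u' -> strong_red (u @ v) (u' @ v)
| strong_appr u v v' : strong_red v v' -> strong_red (u @ v) (u @ v')
| strong_bracket x u v :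
    strong_red u v -> strong_red (bracket x u) (bracket x v).

Inductive lam_red : comb -> comb -> Prop :=
| lam_K u v : lam_red (cK @ u @ v) u
| lam_S u v w : lam_red (cS @ u @ v @ w) (u @ w @ (v @ w))
| lam_I u : lam_red (cI @ u) u
| lam_SKK u v : lam_red (cS @ (cK @ u) @ (cK @ v)) (cK @ (u @ v))
| lam_SKI u : lam_red (cS @ (cK @ u) @ cI) u
| lam_appl u u' v : lam_red u u' -> lam_red (u @ v) (u' @ v)
| lam_appr u v v' : lam_red v v' -> lam_red (u @ v) (u @ v')
| lam_lam x u v : lam_red u v -> lam_red (lam x u) (lam x v).

Definition strong_equiv : relation comb := clos_refl_sym_trans comb strong_red.

Definition lam_equiv : relation comb := clos_refl_sym_trans comb lam_red.

(* Main.v *)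
(* Both equivalences are congruences identifying [S (K u) I] with [u], so
   neither distinguishes [bracket x u] from [lam x u]; closure under one
   abstraction therefore gives closure under the other. The rules [lam_SKK] and
   [lam_SKI] hold for [strong_equiv] by applying both sides to a fresh variable,
   reducing, and abstracting that variable again. *)

Require Import Defs.
From Stdlib Require Import Arith Bool Lia Relations.

(** The target [E] is an arbitrary equivalence: taking it to be a closure yields congruence
    properties, and taking [f] to be the identity yields minimality of the closure. *)
Lemma clos_rst_map (A B : Type) (R : relation A) (E : relation B) (f : A -> B) :
  equivalence B E -> (forall a b, R a b -> E (f a) (f b)) ->
  forall a b, clos_refl_sym_trans A R a b -> E (f a) (f b).
Proof.
  intros [Erefl Etrans Esym] Hf a b H; induction H; eauto.
Qed.

Lemma clos_rst_map_step (A B : Type) (R : relation A) (Q : relation B)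
    (f : A -> B) :
  (forall a b, R a b -> Q (f a) (f b)) ->
  forall a b, clos_refl_sym_trans A R a b ->
    clos_refl_sym_trans B Q (f a) (f b).
Proof.
  intros Hf; apply clos_rst_map; [apply clos_rst_is_equiv|].
  intros a b H; apply rst_step; auto.
Qed.

Lemma clos_rst_app (R : relation comb) :
  (forall u u' v, R u u' -> R (u @ v) (u' @ v)) ->
  (forall u v v', R v v' -> R (u @ v) (u @ v')) ->
  forall u u' v v', clos_refl_sym_trans comb R u u' ->
    clos_refl_sym_trans comb R v v' ->
    clos_refl_sym_trans comb R (u @ v) (u' @ v').
Proof.
  intros Hl Hr u u' v v' Hu Hv; apply rst_trans with (u' @ v).
  - now apply (clos_rst_map_step _ _ R R (fun t => t @ v)); auto.
  - now apply (clos_rst_map_step _ _ R R (App u')); auto.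
Qed.

Lemma strong_equiv_app u u' v v' :
  strong_equiv u u' -> strong_equiv v v' -> strong_equiv (u @ v) (u' @ v').
Proof.
  apply clos_rst_app; [apply strong_appl | apply strong_appr].
Qed.

Lemma lam_equiv_app u u' v v' :
  lam_equiv u u' -> lam_equiv v v' -> lam_equiv (u @ v) (u' @ v').
Proof.
  apply clos_rst_app; [apply lam_appl | apply lam_appr].
Qed.

Lemma is_var_true x t : is_var x t = true -> t = Var x.
Proof.
  destruct t; try discriminate; simpl; rewrite Nat.eqb_eq; congruence.
Qed.

Lemma bracket_notin x u : occurs x u = false -> bracket x u = cK @ u.
Proof.
  intros H; destruct u; simpl in *; try rewrite H; reflexivity.
Qed.

Lemma lam_notin x u : occurs x u = false -> lam x u = cK @ u.
Proof.
  intros H; destruct u; simpl in *; try rewrite H; reflexivity.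
Qed.

Lemma bracket_eta x u : occurs x u = false -> bracket x (u @ Var x) = u.
Proof.
  intros H; simpl; now rewrite H, Nat.eqb_refl.
Qed.

(** The two recursions part only at the eta clause. Keeping [E] abstract lets one induction serve
    both equivalences. *)
Lemma bracket_lam (E : relation comb) :
  equivalence comb E ->
  (forall u u' v v', E u u' -> E v v' -> E (u @ v) (u' @ v')) ->
  (forall u, E (cS @ (cK @ u) @ cI) u) ->
  forall x t, E (bracket x t) (lam x t).
Proof.
  intros [Erefl Etrans Esym] Eapp Eeta x t.
  induction t as [y| | | |u IHu v IHv]; simpl; try apply Erefl.
  destruct (occurs x u || occurs x v); simpl; [|apply Erefl].
  destruct (is_var x v && negb (occurs x u)) eqn:Hx; [|auto].
  (* Eta clause: [bracket] returns [u], while [lam] returns [cS @ (cK @ u) @ cI]. *)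
  apply andb_true_iff in Hx as [Hv Hu].
  apply is_var_true in Hv; subst v; apply negb_true_iff in Hu.
  simpl; rewrite Nat.eqb_refl, lam_notin by assumption; simpl; auto.
Qed.

(** A threshold, unlike a single fresh variable, survives application: any index above the sum of
    two bounds exceeds both. *)
Lemma fresh_bound t : exists n, forall x, n <= x -> occurs x t = false.
Proof.
  induction t as [y| | | |u [n Hn] v [m Hm]]; try (now exists 0).
  - exists (S y); intros x Hx; apply Nat.eqb_neq; lia.
  - exists (n + m); intros x Hx; simpl; rewrite Hn, Hm by lia; reflexivity.
Qed.

Lemma fresh t : exists x, occurs x t = false.
Proof.
  destruct (fresh_bound t) as [n Hn]; exists n; auto.
Qed.

Lemma strong_equiv_bracket x u v :
  strong_equiv u v -> strong_equiv (bracket x u) (bracket x v).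
Proof.
  apply clos_rst_map_step; intros a b; apply strong_bracket.
Qed.

Lemma strong_equiv_SKI u : strong_equiv (cS @ (cK @ u) @ cI) u.
Proof.
  destruct (fresh u) as [x Hx].
  rewrite <- (bracket_eta x (cS @ (cK @ u) @ cI)) by (simpl; now rewrite Hx).
  (* Only the right-hand side is expanded; the first [u] lies inside the left-hand one. *)
  rewrite <- (bracket_eta x u Hx) at 2.
  apply strong_equiv_bracket.
  eapply rst_trans; [apply rst_step, strong_S|].
  apply strong_equiv_app; apply rst_step; constructor.
Qed.

Lemma strong_equiv_SKK u v :
  strong_equiv (cS @ (cK @ u) @ (cK @ v)) (cK @ (u @ v)).
Proof.
  destruct (fresh (u @ v)) as [x Hx].
  rewrite <- (bracket_eta x (cS @ (cK @ u) @ (cK @ v))) by exact Hx.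
  (* The right side is already an abstraction, by the constant clause, so the body to reach is
     [u @ v] with no trailing variable. *)
  rewrite <- (bracket_notin x (u @ v) Hx).
  apply strong_equiv_bracket.
  eapply rst_trans; [apply rst_step, strong_S|].
  apply strong_equiv_app; apply rst_step; constructor.
Qed.

Lemma strong_equiv_bracket_lam x t : strong_equiv (bracket x t) (lam x t).
Proof.
  apply bracket_lam; [apply clos_rst_is_equiv | exact strong_equiv_app |].
  exact strong_equiv_SKI.
Qed.

Lemma lam_equiv_bracket_lam x t : lam_equiv (bracket x t) (lam x t).
Proof.
  apply bracket_lam; [apply clos_rst_is_equiv | exact lam_equiv_app |].
  intros u; apply rst_step, lam_SKI.
Qed.

Lemma strong_equiv_lam x u v :
  strong_equiv u v -> strong_equiv (lam x u) (lam x v).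
Proof.
  intros H; eapply rst_trans; [apply rst_sym, strong_equiv_bracket_lam|].
  eapply rst_trans; [|apply strong_equiv_bracket_lam].
  now apply strong_equiv_bracket.
Qed.

Lemma lam_equiv_bracket x u v :
  lam_equiv u v -> lam_equiv (bracket x u) (bracket x v).
Proof.
  intros H; eapply rst_trans; [apply lam_equiv_bracket_lam|].
  eapply rst_trans; [|apply rst_sym, lam_equiv_bracket_lam].
  revert u v H; apply clos_rst_map_step; intros a b; apply lam_lam.
Qed.

(** A single step may need a zigzag of the other reduction, so the induction hypothesis is only an
    equivalence; hence the abstraction case needs closure of all of [lam_equiv] under [bracket]. *)
Lemma strong_red_lam_equiv u v : strong_red u v -> lam_equiv u v.
Proof.
  induction 1; try (apply rst_step; now constructor).
  - apply lam_equiv_app; [assumption | apply rst_refl].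
  - apply lam_equiv_app; [apply rst_refl | assumption].
  - now apply lam_equiv_bracket.
Qed.

Lemma lam_red_strong_equiv u v : lam_red u v -> strong_equiv u v.
Proof.
  induction 1; try (apply rst_step; now constructor).
  - apply strong_equiv_SKK.
  - apply strong_equiv_SKI.
  - apply strong_equiv_app; [assumption | apply rst_refl].
  - apply strong_equiv_app; [apply rst_refl | assumption].
  - now apply strong_equiv_lam.
Qed.

Theorem theorem2 (u v : comb) : strong_equiv u v <-> lam_equiv u v.
Proof.
  split.
  - apply (clos_rst_map _ _ _ _ (fun t => t) (clos_rst_is_equiv _ _)).
    exact strong_red_lam_equiv.
  - apply (clos_rst_map _ _ _ _ (fun t => t) (clos_rst_is_equiv _ _)).
    exact lam_red_strong_equiv.
Qed.
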